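(* Let $M_k$ and $M_{k-1}$ be the largest and second largest observed serial numbers, and let $$X_k = M_k\,\frac{k+1}{k} - 1, \qquad X_{k-1} = M_{k-1}\,\frac{k+1}{k-1} - 1$$ be the corresponding estimators of $N$. Then $$\mathrm{Var}(X_k) = \frac{(N-k)(N+1)}{k(k+2)}, \qquad \mathrm{Var}(X_{k-1}) = \frac{2(N-k)(N+1)}{(k+2)(k-1)}.$$ The estimator of $N$ using $M_{k-1}$, and more generally the estimator $M_{k-L+1}\,\frac{k+1}{k-L+1} - 1$ using the $L$-th largest observed serial number $M_{k-L+1}$ (with $2\le L\le k$), is worse than the estimator $X_k$ using $M_k$, as its variance is larger. The variance of $X_{k-1}$ is roughly two times the variance of $X_k$. Thus, if only one observed value is to be used, it is best to use the largest.
   Context: There are $N$ tanks, numbered $1,\dots,N$, and $k$ of them are observed ($2\le k\le N$), drawn without replacement so that every $k$-element subset of $\{1,\dots,N\}$ is equally likely. For $1\le L\le k$, $M_{k-L+1}$ denotes the $L$-th largest of the $k$ observed serial numbers. Each estimator is scaled so that its mean is $N$.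
   Formalization: The claims that the other estimators have strictly larger variance and that the ratio of variances is roughly 2 are stated for k < N, since for N = k all variances are 0; there only ''not smaller'' is claimed. *)

(* Defs.v *)
From HB Require Import structures.
From mathcomp Require Import all_boot all_order all_algebra.
From mathcomp Require Import all_classical all_reals all_analysis.

Set Implicit Arguments.
Unset Strict Implicit.
Unset Printing Implicit Defensive.

Import Order.TTheory GRing.Theory Num.Theory.
Local Open Scope ring_scope.

(* The tank with serial number i.+1 is represented by i : 'I_N, so that the
   serial numbers run over 1, ..., N. *)
Definition serials (N : nat) (A : {set 'I_N}) : seq nat :=
  [seq (nat_of_ord i).+1 | i <- enum A].

(* L is 1-based; the value is the junk 0 when A has fewer than L elements. *)
Definition Lth_largest (N L : nat) (A : {set 'I_N}) : nat :=
  nth 0%N (sort geq (serials A)) L.-1.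

Definition uniform_sample (d : measure_display) (T : measurableType d)
    (R : realType) (P : probability T R) (N k : nat)
    (S : T -> {set 'I_N}) : Prop :=
  [/\ forall A : {set 'I_N}, measurable (S @^-1` [set A])%classic,
      forall w : T, #|S w| = k
    & forall A B : {set 'I_N}, #|A| = k -> #|B| = k ->
        P (S @^-1` [set A])%classic = P (S @^-1` [set B])%classic].

(* With M_(k-L+1) the L-th largest observed serial number, this is
   M_(k-L+1) (k+1)/(k-L+1) - 1; X_k is the case L = 1 and X_(k-1) the case
   L = 2. The subtraction k - L is taken in nat, hence requires L <= k. *)
Definition estimator (d : measure_display) (T : measurableType d)
    (R : realType) (N k : nat) (S : T -> {set 'I_N}) (L : nat) : T -> R :=
  fun w => (Lth_largest L (S w))%:R * ((k + 1)%:R / (k - L + 1)%:R) - 1.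

(* Main.v *)
Require Import Defs.
From HB Require Import structures.
From mathcomp Require Import all_boot all_order all_algebra.
From mathcomp Require Import all_classical all_reals all_analysis.
From mathcomp Require Import zify ring.

Set Implicit Arguments.
Unset Strict Implicit.
Unset Printing Implicit Defensive.

Import Order.TTheory GRing.Theory Num.Theory.
Local Open Scope ring_scope.

(** Write M for the L-th largest element of a k-subset A of {1, ..., N} and
    r = k - L + 1 for its rank from below. All moments of M come from one
    identity, [sum_bin_Lth_largest]: over all such A,

      sum of C(M + j - 1, j)  =  C(r + j - 1, j) * C(N + j, k + j).

    The proof is by induction on N, splitting the subsets according to whether
    they contain the top element N. A subset without N is a k-subset of
    {1, ..., N - 1} with the same M. Removing N from a subset that contains it
    lowers both k and L by one, hence keeps r, and keeps M as well unless L = 1,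
    where M = N. The two parts add up by the Pascal rule.

    Since the sample is uniform, expectations are averages over k-subsets
    ([expectation_uniform]), and the identity gives

      E M = r (N + 1) / (k + 1),
      E M (M + 1) = r (r + 1) (N + 1) (N + 2) / ((k + 1) (k + 2)).

    Hence the estimator X_L = M (k + 1) / r - 1 has mean N and variance
    ([variance_estimator])

      Var X_L = (N - k) (N + 1) / (k + 2) * L / (k - L + 1).

    Only the last factor depends on L, and it increases with L; this gives the
    comparison with L = 1. For L = 2 and L = 1 the quotient of the variances is
    2 k / (k - 1) = 2 + 2 / (k - 1), which tends to 2 as k grows. *)

(** * Subsets of an ordinal, split by the top element *)

(** Unlifting at [ord_max] identifies the elements of ['I_N.+1] other than the
    last one with those of ['I_N]; [b] tells whether the last one belongs to the
    set. Every subset of ['I_N.+1] arises this way exactly once. *)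
Definition extend_set N (b : bool) (B : {set 'I_N}) : {set 'I_N.+1} :=
  [set i | if unlift ord_max i is Some j then j \in B else b].

Lemma serials_extend N b (B : {set 'I_N}) :
  serials (extend_set b B) = serials B ++ nseq b N.+1.
Proof.
rewrite /serials /enum_mem -!enumT enum_ordSr filter_rcons.
have mem_max : mem (extend_set b B) ord_max = b.
  by rewrite /= inE unlift_none.
have mem_widen : preim (widen_ord (leqnSn N)) (mem (extend_set b B)) =1 mem B.
  move=> i /=; have -> : widen_ord (leqnSn N) i = lift ord_max i.
    by apply: val_inj; exact: esym (lift_max i).
  by rewrite inE liftK.
rewrite filter_map (eq_filter mem_widen) mem_max.
by case: b {mem_max mem_widen}; rewrite ?map_rcons -?cats1 -map_comp ?cats0.
Qed.

Lemma size_serials N (A : {set 'I_N}) : size (serials A) = #|A|.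
Proof. by rewrite size_map cardE. Qed.

Lemma card_extend_set N b (B : {set 'I_N}) : #|extend_set b B| = (b + #|B|)%N.
Proof. by rewrite -!size_serials serials_extend size_cat size_nseq addnC. Qed.

(** The serial number [N.+1] of the added element exceeds all the others, so in
    decreasing order it comes first. *)
Lemma sort_serials_extend N b (B : {set 'I_N}) :
  sort geq (serials (extend_set b B)) = nseq b N.+1 ++ sort geq (serials B).
Proof.
have geq_tr : transitive geq by move=> x y z xy yz; exact: leq_trans yz xy.
have geq_total : total geq by move=> x y; exact: leq_total.
have geq_anti : antisymmetric geq.
  by move=> x y yx; apply/eqP; rewrite eqn_leq andbC.
rewrite serials_extend -(sorted_sort geq_tr (s := _ ++ sort _ _)); last first.
  case: b => /=; last exact: sort_sorted.
  rewrite path_min_sorted ?sort_sorted// all_sort.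
  by apply/allP => _ /mapP[i _ ->]; rewrite /= ltnS ltnW.
apply/perm_sortP => //.
by rewrite perm_catC perm_cat2l perm_sym perm_sort.
Qed.

Lemma Lth_largest_extend_false N L (B : {set 'I_N}) :
  Lth_largest L (extend_set false B) = Lth_largest L B.
Proof. by rewrite /Lth_largest sort_serials_extend. Qed.

Lemma Lth_largest_extend_true N L (B : {set 'I_N}) :
  Lth_largest L.+1 (extend_set true B) =
  if L is 0 then N.+1 else Lth_largest L B.
Proof. by rewrite /Lth_largest sort_serials_extend; case: L. Qed.

Lemma sum_subsets_ordS N k (F : {set 'I_N.+1} -> nat) :
  (\sum_(A : {set 'I_N.+1} | #|A| == k.+1) F A =
   \sum_(B : {set 'I_N} | #|B| == k.+1) F (extend_set false B) +
   \sum_(B : {set 'I_N} | #|B| == k) F (extend_set true B))%N.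
Proof.
rewrite (reindex (fun p : bool * {set 'I_N} => extend_set p.1 p.2)) /=;
  last first.
  exists (fun A : {set 'I_N.+1} =>
      (ord_max \in A, [set j : 'I_N | lift ord_max j \in A])).
    move=> [b B] _ /=; congr pair; first by rewrite inE unlift_none.
    by apply/setP => i; rewrite !inE liftK.
  move=> A _; apply/setP => i; rewrite inE /=.
  by case: unliftP => [j|] ->; rewrite ?inE.
under eq_bigl do rewrite card_extend_set.
rewrite -(pair_big_dep predT
  (fun (b : bool) (B : {set 'I_N}) => (b + #|B| == k.+1)%N)
  (fun b B => F (extend_set b B))) /=.
by rewrite big_bool addnC.
Qed.

(** * Order statistics summed over all k-subsets *)

(** For m <= n both sides are the multinomial coefficient
    (n + j)! / (m! (n - m)! j!); otherwise both vanish. *)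
Lemma bin_mul_bin_add n m j :
  ('C(m + j, j) * 'C(n + j, m + j) = 'C(n, m) * 'C(n + j, j))%N.
Proof.
have [lt_nm|le_mn] := ltnP n m.
  by rewrite [X in (_ * X)%N]bin_small ?ltn_add2r // (bin_small lt_nm) muln0.
have f0 : (0 < m`! * (n - m)`! * j`!)%N by rewrite !muln_gt0 !fact_gt0.
apply/eqP; rewrite -(eqn_pmul2r f0); apply/eqP.
transitivity (n + j)`!.
  rewrite -(@bin_fact (n + j) (m + j)) ?leq_add2r // subnDr.
  rewrite -(@bin_fact (m + j) j) ?leq_addl // addnK.
  by ring.
rewrite -(@bin_fact (n + j) j) ?leq_addl // addnK -(bin_fact le_mn).
by ring.
Qed.

Lemma card_ksubsets N k : #|[pred A : {set 'I_N} | #|A| == k]| = 'C(N, k).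
Proof.
by rewrite -[in RHS](card_ord N) -card_draws; apply: eq_card => A; rewrite !inE.
Qed.

(** The binomial C(M + j - 1, j) is the rising analogue of M^j / j!, chosen so
    that the sum has a closed form. Here k and L are shifted down by one, so the case
    [L = 0] is that of the largest element: over the subsets that contain the top
    serial number the summand is then constant, and [bin_mul_bin_add] turns their
    total into the second term of the Pascal rule. *)
Lemma sum_bin_Lth_largest j N k L : (L <= k)%N ->
  (\sum_(A : {set 'I_N} | #|A| == k.+1) 'C((Lth_largest L.+1 A + j).-1, j) =
   'C(k - L + j, j) * 'C(N + j, k.+1 + j))%N.
Proof.
elim: N k L => [|N IHN] k L le_Lk.
  rewrite big_pred0 => [|A].
    by rewrite [X in (_ * X)%N]bin_small ?muln0 ?ltn_add2r.
  by apply/negbTE; rewrite neq_ltn ltnS (leq_trans (max_card _)) ?card_ord.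
rewrite sum_subsets_ordS.
under eq_bigr do rewrite Lth_largest_extend_false.
under [X in (_ + X)%N]eq_bigr do rewrite Lth_largest_extend_true.
rewrite IHN // !addSn binS mulnDr; congr addn.
case: L le_Lk => [|L] le_Lk.
  rewrite sum_nat_const subn0 bin_mul_bin_add; congr muln.
  exact: card_ksubsets.
by case: k le_Lk => // k le_Lk; rewrite IHN // subSS.
Qed.

(** * Expectation and variance under uniform sampling *)

Lemma expectation_finite d (T : measurableType d) (R : realType)
    (P : probability T R) (I : finType) (S : T -> I) (g : I -> R) :
  (forall i, measurable (S @^-1` [set i])%classic) ->
  'E_P[g \o S]%E = (\sum_i g i * fine (P (S @^-1` [set i])%classic))%:E.
Proof.
move=> mS; rewrite unlock.
have int_indic i : P.-integrable setT (fun w => (\1_(S @^-1` [set i]) w)%:E).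
  exact: integrable_indic.
under eq_integral => w _.
  rewrite (_ : ((g \o S) w)%:E =
    (\sum_i (g i)%:E * (\1_(S @^-1` [set i]) w)%:E)%E); first over.
  rewrite (bigD1 (S w)) //= big1 => [|i neq_i].
    by rewrite adde0 indicE mem_set // mule1.
  rewrite indicE memNset ?mule0 //= => eq_i.
  by rewrite eq_i eqxx in neq_i.
rewrite integral_sum //; last by move=> i; exact: integrableZl.
rewrite -sumEFin; apply: eq_bigr => i _.
rewrite integralZl // integral_indic // setIT EFinM fineK //.
exact: fin_num_measure.
Qed.

Definition average (R : fieldType) (N k : nat) (g : {set 'I_N} -> R) : R :=
  (\sum_(A : {set 'I_N} | #|A| == k) g A) / 'C(N, k)%:R.

Lemma expectation_uniform d (T : measurableType d) (R : realType)
    (P : probability T R) N k (S : T -> {set 'I_N}) (g : {set 'I_N} -> R) :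
  (k <= N)%N -> uniform_sample P k S ->
  'E_P[g \o S]%E = (average k g)%:E.
Proof.
move=> le_kN [mS cardS unifS].
pose p A := fine (P (S @^-1` [set A])%classic).
have p0 (A : {set 'I_N}) : #|A| != k -> p A = 0.
  move=> cardA; rewrite /p (_ : (S @^-1` [set A])%classic = set0) ?measure0 //.
  by rewrite -subset0 => w /= SwA; rewrite -SwA cardS eqxx in cardA.
have [A0 cardA0] : exists A0 : {set 'I_N}, #|A0| = k.
  have : (0 < #|[set A : {set 'I_N} | #|A| == k]|)%N.
    by rewrite card_draws card_ord bin_gt0.
  by rewrite card_gt0 => /set0Pn[A]; rewrite inE => /eqP; exists A.
have avg_p (h : {set 'I_N} -> R) :
    'E_P[h \o S]%E = (p A0 * \sum_(A : {set 'I_N} | #|A| == k) h A)%:E.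
  rewrite expectation_finite //; congr EFin.
  rewrite (bigID (fun A : {set 'I_N} => #|A| == k)) /= [X in _ + X]big1 => [|A].
    rewrite addr0 mulr_sumr; apply: eq_bigr => A /eqP cardA.
    by rewrite mulrC /p (unifS A A0).
  by move/p0; rewrite /p => ->; rewrite mulr0.
(* The constant function 1 determines the common probability [p A0]. *)
have total_p : p A0 * 'C(N, k)%:R = 1.
  have := avg_p (cst 1); rewrite (_ : cst 1 \o S = cst 1) // expectation_cst.
  case=> one_eq; rewrite [RHS]one_eq; congr (_ * _).
  by rewrite -card_ksubsets -sumr_const.
rewrite avg_p /average; congr EFin; rewrite mulrC; congr (_ * _).
have C0 : 'C(N, k)%:R != 0 :> R by rewrite pnatr_eq0 -lt0n bin_gt0.
by apply: (mulIf C0); rewrite total_p mulVf.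
Qed.

Lemma variance_uniform d (T : measurableType d) (R : realType)
    (P : probability T R) N k (S : T -> {set 'I_N}) (g : {set 'I_N} -> R) :
  (k <= N)%N -> uniform_sample P k S ->
  'V_P[g \o S]%E = (average k (fun A => (g A - average k g) ^+ 2))%:E.
Proof.
move=> le_kN unifS.
rewrite /variance covariance.unlock (expectation_uniform g le_kN unifS) /=.
exact: (expectation_uniform (fun A => (g A - average k g) ^+ 2) le_kN unifS).
Qed.

Lemma averageD (R : fieldType) N k (g h : {set 'I_N} -> R) :
  average k (fun A => g A + h A) = average k g + average k h.
Proof. by rewrite /average big_split mulrDl. Qed.

Lemma averageZ (R : fieldType) N k a (g : {set 'I_N} -> R) :
  average k (fun A => a * g A) = a * average k g.
Proof. by rewrite /average -mulr_sumr mulrA. Qed.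

Lemma average_cst (R : numFieldType) N k (a : R) : (k <= N)%N ->
  average k (fun _ : {set 'I_N} => a) = a.
Proof.
move=> le_kN; rewrite /average sumr_const.
by rewrite card_ksubsets -[a *+ _]mulr_natr mulfK // pnatr_eq0 -lt0n bin_gt0.
Qed.

(** * Moments of the order statistics *)

Lemma average_bin_Lth_largest (R : numFieldType) j N k L :
  (1 <= L <= k)%N ->
  average k (fun A : {set 'I_N} => 'C((Lth_largest L A + j).-1, j)%:R : R) =
  'C(k - L + j, j)%:R * 'C(N + j, k + j)%:R / 'C(N, k)%:R.
Proof.
case: L k => [|L] [|k] //= le_Lk.
by rewrite /average -natr_sum sum_bin_Lth_largest // subSS natrM.
Qed.

Lemma binSS_natr (R : numFieldType) n m :
  'C(n.+1, m.+1)%:R = (n%:R + 1) / (m%:R + 1) * 'C(n, m)%:R :> R.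
Proof.
by rewrite mulrAC !natr1 -natrM (mul_bin_diag n.+1 m) natrM mulrC mulKf.
Qed.

Lemma average_Lth_largest (R : numFieldType) N k L :
  (1 <= L <= k)%N -> (k <= N)%N ->
  average k (fun A : {set 'I_N} => (Lth_largest L A)%:R : R) =
  (k - L + 1)%:R * (N%:R + 1) / (k%:R + 1).
Proof.
move=> le_Lk le_kN.
transitivity (average k
    (fun A : {set 'I_N} => 'C((Lth_largest L A + 1).-1, 1)%:R : R)).
  by congr average; apply/funext => A; rewrite addn1 bin1.
rewrite average_bin_Lth_largest // bin1 addn1 [(N + 1)%N]addn1 [(k + 1)%N]addn1.
have C0 : 'C(N, k)%:R != 0 :> R by rewrite pnatr_eq0 -lt0n bin_gt0.
by rewrite binSS_natr !mulrA mulfK.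
Qed.

(** The rising square M (M + 1) replaces the second moment, as it is twice the
    binomial coefficient C(M + 1, 2), the case j = 2 of the sum. *)
Lemma average_Lth_largest_rising (R : numFieldType) N k L :
  (1 <= L <= k)%N -> (k <= N)%N ->
  average k (fun A : {set 'I_N} =>
    (Lth_largest L A)%:R * ((Lth_largest L A)%:R + 1) : R) =
  (k - L + 1)%:R * ((k - L + 1)%:R + 1) * (N%:R + 1) * (N%:R + 2) /
  ((k%:R + 1) * (k%:R + 2)).
Proof.
have bin2S n : 2 * 'C(n.+1, 2)%:R = n%:R * (n%:R + 1) :> R.
  have := mul_bin_diag n.+1 1; rewrite bin1 => eqn.
  by rewrite -natrM -eqn natrM -natr1 mulrC.
move=> le_Lk le_kN.
transitivity (average k
    (fun A : {set 'I_N} => 2 * 'C((Lth_largest L A + 2).-1, 2)%:R : R)).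
  by congr average; apply/funext => A; rewrite addn2 bin2S.
rewrite averageZ average_bin_Lth_largest // !mulrA.
rewrite addn1 !addn2 bin2S !binSS_natr -[k.+1%:R]natr1 -[N.+1%:R]natr1.
have C0 : 'C(N, k)%:R != 0 :> R by rewrite pnatr_eq0 -lt0n bin_gt0.
have k1 : k%:R + 1 != 0 :> R by rewrite natr1 pnatr_eq0.
have k2 : k%:R + 2 != 0 :> R by rewrite -natrD addn2 pnatr_eq0.
by field; rewrite C0 k1 k2.
Qed.

(** * Mean and variance of the estimators *)

Lemma mean_estimator d (T : measurableType d) (R : realType)
    (P : probability T R) N k (S : T -> {set 'I_N}) L :
  (1 <= L <= k)%N -> (k <= N)%N -> uniform_sample P k S ->
  'E_P[estimator R k S L]%E = (N%:R)%:E.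
Proof.
move=> le_Lk le_kN unifS.
pose c : R := (k + 1)%:R / (k - L + 1)%:R.
rewrite (expectation_uniform
  (fun A => (Lth_largest L A)%:R * c - 1 : R) le_kN unifS).
congr EFin; rewrite averageD average_cst //.
under eq_fun do rewrite mulrC.
rewrite averageZ average_Lth_largest // /c.
have r0 : (k - L + 1)%:R != 0 :> R by rewrite addn1 pnatr_eq0.
have k1 : k%:R + 1 != 0 :> R by rewrite natr1 pnatr_eq0.
move: (k - L + 1)%:R r0 => r r0; rewrite natrD; field.
by rewrite r0 k1.
Qed.

(** With c = (k + 1) / r the deviation X_L - N is c M - (N + 1), whose square is
    a combination of M (M + 1), M and 1. The factor L arises as k + 1 - r. *)
Lemma variance_estimator d (T : measurableType d) (R : realType)
    (P : probability T R) N k (S : T -> {set 'I_N}) L :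
  (1 <= L <= k)%N -> (k <= N)%N -> uniform_sample P k S ->
  'V_P[estimator R k S L]%E =
  (L%:R * (N%:R - k%:R) * (N%:R + 1) / ((k - L + 1)%:R * (k%:R + 2)))%:E.
Proof.
move=> le_Lk le_kN unifS.
pose c : R := (k + 1)%:R / (k - L + 1)%:R.
pose M (A : {set 'I_N}) : R := (Lth_largest L A)%:R.
have avg_X : average k (fun A => M A * c - 1) = N%:R.
  apply: EFin_inj; rewrite -(mean_estimator le_Lk le_kN unifS).
  by rewrite -(expectation_uniform (fun A => M A * c - 1) le_kN unifS).
rewrite (variance_uniform (fun A => M A * c - 1) le_kN unifS) avg_X.
congr EFin.
transitivity (average k (fun A =>
    c ^+ 2 * (M A * (M A + 1)) +
    (- (c ^+ 2 + 2 * c * (N%:R + 1)) * M A + (N%:R + 1) ^+ 2))).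
  by congr average; apply/funext => A; ring.
rewrite 2!averageD 2!averageZ average_cst // average_Lth_largest //.
rewrite average_Lth_largest_rising // /c.
have -> : L%:R = k%:R + 1 - (k - L + 1)%:R :> R.
  rewrite natrD natrB; last by case/andP: le_Lk.
  by ring.
have r0 : (k - L + 1)%:R != 0 :> R by rewrite addn1 pnatr_eq0.
have k1 : k%:R + 1 != 0 :> R by rewrite natr1 pnatr_eq0.
have k2 : k%:R + 2 != 0 :> R by rewrite -natrD addn2 pnatr_eq0.
move: (k - L + 1)%:R r0 => r r0; rewrite natrD; field.
by rewrite r0 k1 k2.
Qed.

Theorem mainTheorem4 (R : realType) :
  (forall (d : measure_display) (T : measurableType d) (P : probability T R)
      (N k : nat) (S : T -> {set 'I_N}),
    (2 <= k <= N)%N -> uniform_sample P k S ->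
    let X : nat -> T -> R := estimator R k S in
    [/\ forall L : nat, (1 <= L <= k)%N -> 'E_P[X L]%E = (N%:R)%:E,
        'V_P[X 1%N]%E =
          ((N%:R - k%:R) * (N%:R + 1) / (k%:R * (k%:R + 2)))%:E,
        'V_P[X 2%N]%E =
          (2 * (N%:R - k%:R) * (N%:R + 1) / ((k%:R + 2) * (k%:R - 1)))%:E,
        (k < N)%N -> forall L : nat, (2 <= L <= k)%N ->
          ('V_P[X 1%N] < 'V_P[X L])%E
      & forall L : nat, (1 <= L <= k)%N -> ('V_P[X 1%N] <= 'V_P[X L])%E])
  /\
  (forall e : R, 0 < e -> exists K : nat,
    forall (d : measure_display) (T : measurableType d) (P : probability T R)
      (N k : nat) (S : T -> {set 'I_N}),
    (2 <= k)%N -> (K <= k)%N -> (k < N)%N -> uniform_sample P k S ->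
    `| fine 'V_P[estimator R k S 2]%E / fine 'V_P[estimator R k S 1]%E - 2 |
      < e).
Proof.
split=> [d T P N k S /andP[k_ge2 le_kN] unifS X | e e_gt0].
  have k_ge1 : (1 <= 1 <= k)%N by exact: ltnW.
  have V1 := variance_estimator k_ge1 le_kN unifS.
  have nonneg_scale : 0 <= (N%:R - k%:R) * (N%:R + 1) / (k%:R + 2) :> R.
    by rewrite divr_ge0 ?mulr_ge0 ?subr_ge0 ?ler_nat ?addr_ge0.
  have V_scale L : (L%:R * (N%:R - k%:R) * (N%:R + 1) /
      ((k - L + 1)%:R * (k%:R + 2))) =
      (N%:R - k%:R) * (N%:R + 1) / (k%:R + 2) * (L%:R / (k - L + 1)%:R) :> R.
    by rewrite invfM; ring.
  split=> [L le_Lk||| lt_kN L /andP[L_ge2 le_Lk] | L /andP[L_ge1 le_Lk]].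
  - exact: mean_estimator.
  - by rewrite V1 subnK ?mul1r // ltnW.
  - rewrite /X variance_estimator // natrD natrB // mulrC.
    congr EFin; rewrite [in RHS]mulrC; congr (_^-1 * _).
    by ring.
  - rewrite V1 variance_estimator ?(ltnW L_ge2) // lte_fin !V_scale.
    rewrite ltr_pM2l; last first.
      by rewrite divr_gt0 ?mulr_gt0 ?subr_gt0 ?ltr_nat // natr1 ltr0n.
    rewrite ltr_pdivrMr ?ltr0n ?addn1 // mulrAC ltr_pdivlMr ?ltr0n //.
    by rewrite -!natrM ltr_nat; nia.
  - rewrite V1 variance_estimator ?L_ge1 // lee_fin !V_scale.
    rewrite ler_wpM2l //.
    rewrite ler_pdivrMr ?ltr0n ?addn1 // mulrAC ler_pdivlMr ?ltr0n //.
    by rewrite -!natrM ler_nat; nia.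
(* The distance of the ratio to 2 is 2 / (k - 1), which is below e as soon as
   k - 1 exceeds 2 / e. *)
exists (Num.bound (2 / e)).+1 => d T P N k S k_ge2 le_Kk lt_kN unifS.
rewrite !variance_estimator ?(ltnW lt_kN) ?(ltnW k_ge2) //=.
have k_gt1 : 0 < k%:R - 1 :> R by rewrite subr_gt0 (ltr_nat _ 1).
have k0 : k%:R != 0 :> R by rewrite pnatr_eq0 -lt0n ltnW.
have k2 : k%:R + 2 != 0 :> R by rewrite -natrD addn2 pnatr_eq0.
have N1 : N%:R + 1 != 0 :> R by rewrite natr1 pnatr_eq0.
have Nk : N%:R - k%:R != 0 :> R by rewrite gt_eqF // subr_gt0 ltr_nat.
rewrite (_ : _ - 2 = 2 / (k%:R - 1)); last first.
  rewrite subnK ?(ltnW k_ge2) // natrD natrB //.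
  have -> : k%:R - 2 + 1 = k%:R - 1 :> R by ring.
  by field; rewrite k0 k2 N1 Nk lt0r_neq0.
rewrite ger0_norm ?divr_ge0 ?ltW // ltr_pdivrMr // mulrC -ltr_pdivrMr //.
have := archi_boundP (divr_ge0 (ler0n R 2) (ltW e_gt0)).
move=> /lt_le_trans; apply.
by rewrite lerBrDr natr1 ler_nat.
Qed.
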